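(* Consider a single-input single-output system $x_{k+1}=Ax_k+Bu_k$, $y_k=Cx_k$ with $A\in\mathbb{R}^{n_x\times n_x}$, $B\in\mathbb{R}^{n_x\times1}$, $C\in\mathbb{R}^{1\times n_x}$, spectral radius $\rho(A)<1$, $(A,B)$ controllable and $(A,C)$ observable, with Markov parameters $g_i=CA^iB$. Let $p\ge n_x$, $n=n_x+p+1$, and let $\hat g_0,\dots,\hat g_{n-1}\in\mathbb{R}$ be estimates of $g_0,\dots,g_{n-1}$. Let $\hat\sigma_{n_x+1}$ be the $(n_x+1)$-th largest singular value of the Hankel matrix $\hat{\mathcal H}_{n_xp}$, let $\hat\sigma_{n_x}^{+}$ be the $n_x$-th largest singular value of $\hat{\mathcal H}_{n_xp}^{+}$ (its first $n_x$ rows), and let $\hat\delta:=\hat\sigma_{n_x}^{+}-\hat\sigma_{n_x+1}$. Then $$\hat\delta\le\hat\sigma_{n_x}^{+}\le \Phi(A)^2\,\|C\|\,\|B\|\,\frac{1-\rho(A)^{n-n_x}}{1-\rho(A)}+\left\|\tilde{\mathcal H}_{n_xp}^{+}\right\|,$$ where $\Phi(A):=\sup_{\tau\ge0}\dfrac{\|A^\tau\|}{\rho(A)^{\tau/2}}$ (supremum over nonnegative integers $\tau$), which is finite.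
   Context: $\|\cdot\|$ denotes the spectral norm (Euclidean norm for vectors) and $\rho(\cdot)$ the spectral radius. $\mathcal H_{n_xp}\in\mathbb{R}^{(n_x+1)\times(p+1)}$ is the Hankel matrix with $(i,j)$ entry $g_{i+j-2}$, and $\mathcal H_{n_xp}^{+}\in\mathbb{R}^{n_x\times(p+1)}$ consists of its first $n_x$ rows; $\hat{\mathcal H}_{n_xp}$ and $\hat{\mathcal H}_{n_xp}^{+}$ are the same matrices with $g_i$ replaced by $\hat g_i$. $\tilde{\mathcal H}_{n_xp}^{+}=\hat{\mathcal H}_{n_xp}^{+}-\mathcal H_{n_xp}^{+}$ is the estimation error. The definition of $\Phi(A)$ presupposes $\rho(A)>0$. *)

(* Defs.v *)
From HB Require Import structures.
From mathcomp Require Import all_boot all_order all_algebra.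
From mathcomp Require Import complex.
From mathcomp Require Import boolp classical_sets reals constructive_ereal ereal.
From mathcomp Require Import exp.

Set Implicit Arguments.
Unset Strict Implicit.
Unset Printing Implicit Defensive.

Import Order.TTheory GRing.Theory Num.Theory.

Local Open Scope classical_set_scope.
Local Open Scope ring_scope.

(* MathComp-Analysis puts the max norm on matrices, so the Euclidean and the
   induced (spectral) norm are defined here. *)
Definition l2norm (R : realType) (n : nat) (x : 'cV[R]_n) : R :=
  Num.sqrt (\sum_(i < n) x i 0 ^+ 2).

Definition spectral_norm (R : realType) (m n : nat) (M : 'M[R]_(m, n)) : R :=
  sup [set l2norm (M *m x) | x in [set x : 'cV[R]_n | l2norm x <= 1]].

(* Complex eigenvalues with algebraic multiplicity, in unspecified order:
   [closed_field_poly_normal] factors the (monic) characteristic polynomial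
   as the product of the 'X - z%:P over this sequence. *)
Definition eigenvalues (R : realType) (n : nat) (M : 'M[R]_n) : seq R[i] :=
  sval (closed_field_poly_normal (char_poly (map_mx (real_complex R) M))).

Definition spectral_radius (R : realType) (n : nat) (M : 'M[R]_n) : R :=
  \big[Num.max/0]_(z <- eigenvalues M) complex.Re `|z|.

(* Square roots of the (real, nonnegative) eigenvalues of M^T M, in
   nonincreasing order.  An m x n matrix with m < n gets n - m trailing zeros
   in addition to its m singular values. *)
Definition singular_values (R : realType) (m n : nat) (M : 'M[R]_(m, n)) :
    seq R :=
  sort >=%R [seq Num.sqrt (complex.Re z) | z <- eigenvalues (M^T *m M)].

(* k-th largest singular value, counted from k = 1. *)
Definition singular_value (R : realType) (m n : nat) (k : nat)
    (M : 'M[R]_(m, n)) : R :=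
  (singular_values M)`_k.-1.

(* x_0 = x0 and x_{k+1} = A x_k + B u_k. *)
Fixpoint state (R : realType) (nx : nat) (A : 'M[R]_nx) (B : 'cV[R]_nx)
    (x0 : 'cV[R]_nx) (u : nat -> R) (k : nat) : 'cV[R]_nx :=
  if k is k'.+1 then A *m state A B x0 u k' + u k' *: B else x0.

Definition output (R : realType) (nx : nat) (A : 'M[R]_nx) (B : 'cV[R]_nx)
    (C : 'rV[R]_nx) (x0 : 'cV[R]_nx) (u : nat -> R) (k : nat) : R :=
  (C *m state A B x0 u k) 0 0.

(* Any state can be steered to any other one in finite time; this is the
   notion characterized by the Kalman rank test also when A is singular. *)
Definition controllable (R : realType) (nx : nat) (A : 'M[R]_nx)
    (B : 'cV[R]_nx) : Prop :=
  forall x0 x1 : 'cV[R]_nx, exists (u : nat -> R) (k : nat),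
    state A B x0 u k = x1.

(* The initial state is determined by the output.  By linearity the input is
   immaterial, so the unforced response (B = 0, u = 0) is used. *)
Definition observable (R : realType) (nx : nat) (A : 'M[R]_nx)
    (C : 'rV[R]_nx) : Prop :=
  forall x0 x1 : 'cV[R]_nx,
    (forall k : nat, output A 0 C x0 (fun=> 0) k = output A 0 C x1 (fun=> 0) k)
    -> x0 = x1.

Definition markov (R : realType) (nx : nat) (A : 'M[R]_nx) (B : 'cV[R]_nx)
    (C : 'rV[R]_nx) (i : nat) : R :=
  (C *m A ^+ i *m B) 0 0.

(* Indices start at 0 here, so the (i, j) entry is g_(i + j). *)
Definition hankel (R : realType) (nx p : nat) (g : nat -> R) :
    'M[R]_(nx + 1, p + 1) :=
  \matrix_(i < nx + 1, j < p + 1) g (i + j)%N.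

Definition hankel_plus (R : realType) (nx p : nat) (g : nat -> R) :
    'M[R]_(nx, p + 1) :=
  usubmx (hankel nx p g).

Definition Phi (R : realType) (nx : nat) (A : 'M[R]_nx) : \bar R :=
  ereal_sup [set (spectral_norm (A ^+ tau)
                  / spectral_radius A `^ (tau%:R / 2))%:E | tau in [set: nat]].

(* Main.v *)
Require Import Defs.
From HB Require Import structures.
From mathcomp Require Import all_boot all_order all_algebra.
From mathcomp Require Import complex.
From mathcomp Require Import boolp classical_sets reals constructive_ereal ereal.
From mathcomp Require Import exp.
From mathcomp Require Import ring lra.

Set Implicit Arguments.
Unset Strict Implicit.
Unset Printing Implicit Defensive.

Import Order.TTheory GRing.Theory Num.Theory.

Local Open Scope ring_scope.

(* Every singular value is at most the spectral norm, so by the triangle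
   inequality it suffices to bound the norm of the true Hankel matrix.  Its
   Frobenius norm will do: g_(i+j) = (C A^i)(A^j B) is at most
   |C| |B| Phi^2 rho^((i+j)/2), and the squares sum to a product of two
   geometric sums.  Phi is finite because rho < sqrt rho: by Cayley-Hamilton
   the powers of A are O(mu^t) for every mu > rho. *)

(** Lagrange's identity: twice the gap between the two sides is a double sum of squares. *)
Lemma cauchy_schwarz_sum (R : realDomainType) (I : finType) (a b : I -> R) :
  (\sum_i a i * b i) ^+ 2 <= (\sum_i a i ^+ 2) * (\sum_i b i ^+ 2).
Proof.
have lagrange : \sum_i \sum_j (a i * b j - a j * b i) ^+ 2 =
    2 * ((\sum_i a i ^+ 2) * (\sum_i b i ^+ 2) - (\sum_i a i * b i) ^+ 2).
  have sumM (f g : I -> R) : \sum_i \sum_j f i * g j = (\sum_i f i) * \sum_i g i.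
    by rewrite mulr_suml; apply: eq_bigr => i _; rewrite mulr_sumr.
  transitivity (\sum_i \sum_j (a i ^+ 2 * b j ^+ 2 + b i ^+ 2 * a j ^+ 2
                               - (2 * (a i * b i)) * (a j * b j))).
    by apply: eq_bigr => i _; apply: eq_bigr => j _; ring.
  under eq_bigr do rewrite sumrB big_split /=.
  by rewrite sumrB big_split /= !sumM -mulr_sumr; ring.
have : 0 <= \sum_i \sum_j (a i * b j - a j * b i) ^+ 2.
  by apply: sumr_ge0 => i _; apply: sumr_ge0 => j _; exact: sqr_ge0.
by rewrite lagrange pmulr_rge0 ?ltr0n// subr_ge0.
Qed.

(** * Euclidean, Frobenius and spectral norms *)

Section EuclideanNorm.
Variable R : realType.

Lemma l2norm_ge0 n (x : 'cV[R]_n) : 0 <= l2norm x.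
Proof. exact: sqrtr_ge0. Qed.

Lemma sqr_l2norm n (x : 'cV[R]_n) : l2norm x ^+ 2 = \sum_i x i 0 ^+ 2.
Proof. by rewrite sqr_sqrtr// sumr_ge0// => i _; exact: sqr_ge0. Qed.

Lemma sqr_l2norm_dot n (x : 'cV[R]_n) : l2norm x ^+ 2 = (x^T *m x) 0 0.
Proof.
by rewrite sqr_l2norm mxE; apply: eq_bigr => i _; rewrite mxE expr2.
Qed.

Lemma l2norm0 n : l2norm (0 : 'cV[R]_n) = 0.
Proof.
by rewrite /l2norm big1 ?sqrtr0// => i _; rewrite mxE expr0n.
Qed.

Lemma l2norm_eq0 n (x : 'cV[R]_n) : l2norm x = 0 -> x = 0.
Proof.
move=> x0; have := sqr_l2norm x; rewrite x0 expr0n /= => /esym/eqP.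
rewrite psumr_eq0 => [/allP h|i _]; last exact: sqr_ge0.
apply/matrixP => i j; rewrite ord1 mxE; apply/eqP.
by have := h i (mem_index_enum i); rewrite sqrf_eq0.
Qed.

Lemma l2normZ n (c : R) (x : 'cV[R]_n) : l2norm (c *: x) = `|c| * l2norm x.
Proof.
apply/eqP; rewrite -(eqrXn2 (n := 2)) ?mulr_ge0 ?l2norm_ge0//.
rewrite exprMn !sqr_l2norm real_normK ?num_real// mulr_sumr.
by apply/eqP/eq_bigr => i _; rewrite mxE exprMn.
Qed.

Lemma dot_le_l2norm n (x : 'rV[R]_n) (y : 'cV[R]_n) :
  `|(x *m y) 0 0| <= l2norm x^T * l2norm y.
Proof.
rewrite -(ler_pXn2r (n := 2)) ?nnegrE ?mulr_ge0 ?l2norm_ge0//.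
rewrite exprMn !sqr_l2norm real_normK ?num_real// mxE.
under [in leRHS]eq_bigr do rewrite mxE.
exact: cauchy_schwarz_sum.
Qed.

Lemma l2normD n (x y : 'cV[R]_n) : l2norm (x + y) <= l2norm x + l2norm y.
Proof.
rewrite -(ler_pXn2r (n := 2)) ?nnegrE ?addr_ge0 ?l2norm_ge0//.
have -> : l2norm (x + y) ^+ 2 =
    l2norm x ^+ 2 + l2norm y ^+ 2 + 2 * (x^T *m y) 0 0.
  rewrite !sqr_l2norm mxE mulr_sumr -!big_split /=.
  by apply: eq_bigr => i _; rewrite !mxE; ring.
have := dot_le_l2norm x^T y; rewrite trmxK => /(le_trans (ler_norm _)).
by rewrite sqrrD; lra.
Qed.

(** Cauchy-Schwarz applied to each row of [M]. The Frobenius constant serves twice: it shows that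
    the set defining [spectral_norm] is bounded, and it later estimates the Hankel matrix. *)
Lemma l2norm_mulmx_frobenius m n (M : 'M[R]_(m, n)) (x : 'cV[R]_n) :
  l2norm (M *m x) <= Num.sqrt (\sum_i \sum_j M i j ^+ 2) * l2norm x.
Proof.
have frob_ge0 : 0 <= \sum_i \sum_j M i j ^+ 2.
  by apply: sumr_ge0 => i _; apply: sumr_ge0 => j _; exact: sqr_ge0.
rewrite -(ler_pXn2r (n := 2)) ?nnegrE ?mulr_ge0 ?l2norm_ge0 ?sqrtr_ge0//.
rewrite exprMn (sqr_sqrtr frob_ge0) !sqr_l2norm mulr_suml.
by apply: ler_sum => i _; rewrite mxE; exact: cauchy_schwarz_sum.
Qed.

Lemma spectral_norm_le m n (M : 'M[R]_(m, n)) (c : R) :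
  (forall x : 'cV[R]_n, l2norm x <= 1 -> l2norm (M *m x) <= c) ->
  spectral_norm M <= c.
Proof.
move=> Mc; apply: ge_sup; last by move=> _ [x /= x1 <-]; exact: Mc.
(* The zero vector shows, in every dimension, that the set under the supremum is nonempty. *)
by exists (l2norm (M *m 0)), 0 => //=; rewrite l2norm0 ler01.
Qed.

Lemma spectral_norm_le_frobenius m n (M : 'M[R]_(m, n)) :
  spectral_norm M <= Num.sqrt (\sum_i \sum_j M i j ^+ 2).
Proof.
apply: spectral_norm_le => x x1.
by rewrite (le_trans (l2norm_mulmx_frobenius M x))// ler_piMr// sqrtr_ge0.
Qed.

Lemma l2norm_mulmx_unit m n (M : 'M[R]_(m, n)) (x : 'cV[R]_n) :
  l2norm x <= 1 -> l2norm (M *m x) <= spectral_norm M.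
Proof.
move=> x1; apply: ub_le_sup; last by exists x.
(* With this upper bound, [sup] is a genuine supremum and not a default value. *)
exists (Num.sqrt (\sum_i \sum_j M i j ^+ 2)) => _ [y /= y1 <-].
by rewrite (le_trans (l2norm_mulmx_frobenius M y))// ler_piMr// sqrtr_ge0.
Qed.

Lemma spectral_norm_ge0 m n (M : 'M[R]_(m, n)) : 0 <= spectral_norm M.
Proof.
apply: le_trans (l2norm_ge0 (M *m 0)) _.
by apply: l2norm_mulmx_unit; rewrite l2norm0 ler01.
Qed.

Lemma l2norm_mulmx_le m n (M : 'M[R]_(m, n)) (x : 'cV[R]_n) :
  l2norm (M *m x) <= spectral_norm M * l2norm x.
Proof.
have [x0|x_neq0] := eqVneq (l2norm x) 0.
  by rewrite (l2norm_eq0 x0) mulmx0 !l2norm0 mulr0.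
have x_gt0 : 0 < l2norm x by rewrite lt_def x_neq0 l2norm_ge0.
have xV_ge0 : 0 <= (l2norm x)^-1 by rewrite invr_ge0 ltW.
have /(l2norm_mulmx_unit M) : l2norm ((l2norm x)^-1 *: x) <= 1.
  by rewrite l2normZ ger0_norm// mulVf.
by rewrite -scalemxAr l2normZ ger0_norm// ler_pdivrMl// mulrC.
Qed.

Lemma spectral_normD m n (M N : 'M[R]_(m, n)) :
  spectral_norm (M + N) <= spectral_norm M + spectral_norm N.
Proof.
apply: spectral_norm_le => x x1; rewrite mulmxDl.
by apply: le_trans (l2normD _ _) _; rewrite lerD// l2norm_mulmx_unit.
Qed.

End EuclideanNorm.

(** * Eigenvalues and singular values *)

Section Eigenvalues.
Variable R : realType.

Lemma char_poly_eigenvalues n (M : 'M[R]_n) :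
  char_poly (map_mx (real_complex R) M)
  = \prod_(z <- eigenvalues M) ('X - z%:P).
Proof.
rewrite /eigenvalues; case: closed_field_poly_normal => r /= {1}->.
by rewrite (monicP (char_poly_monic _)) scale1r.
Qed.

Lemma norm_eigenvalue_le n (M : 'M[R]_n) z :
  z \in eigenvalues M -> `|z| <= (spectral_radius M)%:C%C.
Proof.
move=> zM; rewrite normc_def lecR.
have := le_bigmax_seq 0 z xpredT (fun z : R[i] => complex.Re `|z|) zM isT.
by rewrite normc_def.
Qed.

(** [x] and [y] are the real and imaginary parts of a complex left eigenvector; since [M] is real,
    its eigenvector equation separates into the two displayed ones. Real norms thus become
    applicable to a complex eigenvalue. *)
Lemma eigenvalues_real_pair n (M : 'M[R]_n) z : z \in eigenvalues M ->
  exists x y : 'rV[R]_n,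
    [/\ (x != 0) || (y != 0),
        x *m M = complex.Re z *: x - complex.Im z *: y &
        y *m M = complex.Re z *: y + complex.Im z *: x].
Proof.
move=> zM; have : eigenvalue (map_mx (real_complex R) M) z.
  by rewrite eigenvalue_root_char char_poly_eigenvalues root_prod_XsubC.
move=> /eigenvalueP[v vM v0].
exists (map_mx (@complex.Re R) v), (map_mx (@complex.Im R) v).
have ReD : {morph (@complex.Re R) : a b / a + b} by case=> ? ? [].
have ImD : {morph (@complex.Im R) : a b / a + b} by case=> ? ? [].
split.
- apply: contraNT v0; rewrite negb_or !negbK.
  move=> /andP[/eqP/matrixP x0 /eqP/matrixP y0].
  apply/eqP/matrixP => i j; have := x0 i j; have := y0 i j; rewrite !mxE.
  by case: (v i j) => a b /= -> ->.
- apply/matrixP => i j; have /matrixP/(_ i j)/(congr1 (@complex.Re R)) := vM.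
  rewrite !mxE (big_morph _ ReD (erefl : complex.Re (0 : R[i]) = 0)) => h.
  transitivity (complex.Re (z * v i j)); last by case: (z) (v i j) => ? ? [].
  rewrite -h; apply: eq_bigr => k _; rewrite !mxE.
  by case: (v i k) => a b /=; rewrite mulr0 subr0.
- apply/matrixP => i j; have /matrixP/(_ i j)/(congr1 (@complex.Im R)) := vM.
  rewrite !mxE (big_morph _ ImD (erefl : complex.Im (0 : R[i]) = 0)) => h.
  transitivity (complex.Im (z * v i j)); last by case: (z) (v i j) => ? ? [].
  rewrite -h; apply: eq_bigr => k _; rewrite !mxE.
  by case: (v i k) => a b /=; rewrite mulr0 add0r.
Qed.

(** A Rayleigh quotient in real form: adding the quadratic forms at [x] and [y] eliminates the
    imaginary part of [z], so [complex.Re z] is the quotient of [|M x|^2 + |M y|^2] by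
    [|x|^2 + |y|^2]. *)
Lemma Re_eigenvalue_gram_le m n (M : 'M[R]_(m, n)) z :
  z \in eigenvalues (M^T *m M) -> complex.Re z <= spectral_norm M ^+ 2.
Proof.
move=> /eigenvalues_real_pair[x [y [xy0 xM yM]]].
have gramE (u : 'rV[R]_n) :
    l2norm (M *m u^T) ^+ 2 = (u *m (M^T *m M) *m u^T) 0 0.
  by rewrite sqr_l2norm_dot trmx_mul trmxK !mulmxA.
have normE (u : 'rV[R]_n) : (u *m u^T) 0 0 = l2norm u^T ^+ 2.
  by rewrite sqr_l2norm_dot trmxK.
have dotC : (y *m x^T) 0 0 = (x *m y^T) 0 0.
  by rewrite !mxE; apply: eq_bigr => k _; rewrite !mxE mulrC.
(* The cross terms cancel because [M^T *m M] is symmetric. *)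
have rayleigh : l2norm (M *m x^T) ^+ 2 + l2norm (M *m y^T) ^+ 2 =
    complex.Re z * (l2norm x^T ^+ 2 + l2norm y^T ^+ 2).
  have entryD (P Q : 'M[R]_1) : (P + Q) 0 0 = P 0 0 + Q 0 0 by rewrite mxE.
  have entryN (P : 'M[R]_1) : (- P) 0 0 = - P 0 0 by rewrite mxE.
  have entryZ c (P : 'M[R]_1) : (c *: P) 0 0 = c * P 0 0 by rewrite mxE.
  rewrite !gramE xM yM mulmxDl mulNmx mulmxDl -!scalemxAl.
  by rewrite !(entryD, entryN, entryZ) dotC !normE; ring.
have bound u : l2norm (M *m u) ^+ 2 <= spectral_norm M ^+ 2 * l2norm u ^+ 2.
  rewrite -exprMn ler_pXn2r ?nnegrE ?mulr_ge0 ?l2norm_ge0 ?spectral_norm_ge0//.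
  exact: l2norm_mulmx_le.
have norm_gt0 : 0 < l2norm x^T ^+ 2 + l2norm y^T ^+ 2.
  have pos (u : 'rV[R]_n) : u != 0 -> 0 < l2norm u^T ^+ 2.
    move=> u0; rewrite exprn_gt0// lt_def l2norm_ge0 andbT.
    apply: contraNneq u0 => /l2norm_eq0/(congr1 trmx).
    by rewrite trmxK trmx0 => ->.
  case/orP: xy0 => /pos h; first by rewrite ltr_wpDr ?sqr_ge0.
  by rewrite ltr_wpDl ?sqr_ge0.
by rewrite -(ler_pM2r norm_gt0) -rayleigh mulrDr lerD.
Qed.

(** The lower bound allows [sigma_hat] to be dropped; the upper bound reduces the main estimate to
    spectral norms. *)
Lemma singular_value_bounds m n k (M : 'M[R]_(m, n)) :
  0 <= singular_value k M <= spectral_norm M.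
Proof.
rewrite /singular_value.
have [k_lt|k_ge] := ltnP k.-1 (size (singular_values M)); last first.
  (* An index past the end reads the default 0, which satisfies both bounds. *)
  by rewrite nth_default// lexx spectral_norm_ge0.
have := mem_nth 0 k_lt; rewrite mem_sort => /mapP[z zM ->].
rewrite sqrtr_ge0 -(ger0_norm (spectral_norm_ge0 M)) -sqrtr_sqr ler_wsqrtr//.
exact: Re_eigenvalue_gram_le.
Qed.

End Eigenvalues.

(** * Growth of matrix powers and finiteness of [Phi] *)

(** The constant [L] satisfies [K <= L * (mu - r)], so [r * L + K <= L * mu] closes the induction;
    its summand [a 0] covers the base case. The strict gap between [r] and [mu] avoids a factor
    polynomial in [t]. *)
Lemma geometric_recurrence_bound (F : numFieldType) (a : nat -> F) (mu r K : F) :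
  0 <= a 0 -> 0 <= r -> r < mu -> 0 <= K ->
  (forall t, a t.+1 <= r * a t + K * mu ^+ t) ->
  forall t, a t <= (a 0 + K / (mu - r)) * mu ^+ t.
Proof.
move=> a0 r0 rmu K0 rec.
have gap_gt0 : 0 < mu - r by rewrite subr_gt0.
have mu_ge0 : 0 <= mu by apply: le_trans (ltW rmu).
set L := a 0 + _.
have K_le : K <= L * (mu - r).
  by rewrite /L mulrDl divfK ?gt_eqF// lerDr mulr_ge0// ltW.
elim=> [|t IH]; first by rewrite expr0 mulr1 /L lerDl divr_ge0// ltW.
apply: le_trans (rec t) _.
apply: (@le_trans _ _ (r * (L * mu ^+ t) + L * (mu - r) * mu ^+ t)).
  by rewrite lerD ?ler_wpM2l// ler_wpM2r// exprn_ge0.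
by rewrite le_eqVlt; apply/orP; left; apply/eqP; rewrite exprS; ring.
Qed.

(* Peeling off one linear factor [A - z] turns the bound for the remaining
   factors into a scalar recurrence of rate [`|z|] forced by [mu ^+ t]. *)
Lemma annihilated_powers_bound (F : numFieldType) n (A : 'M[F]_n.+1) (mu : F)
    (s : seq F) (W : 'M[F]_n.+1) :
  (forall z, z \in s -> `|z| < mu) ->
  horner_mx A (\prod_(z <- s) ('X - z%:P)) * W = 0 ->
  forall i j, exists2 K : F, 0 <= K &
    forall t, `|(A ^+ t * W) i j| <= K * mu ^+ t.
Proof.
elim: s W => [|z s IH] W s_mu.
  rewrite big_nil rmorph1 mul1r => -> i j; exists 0 => // t.
  by rewrite mulr0 mxE normr0 mul0r.
(* Commuting the product puts the factor of [z] next to [W], so the remaining factors annihilate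
   [(A - z) W], to which the induction hypothesis applies. *)
rewrite big_cons mulrC rmorphM /= -mulrA => annW i j.
have z_mu : `|z| < mu by apply: s_mu; rewrite mem_head.
have s_mu' z' : z' \in s -> `|z'| < mu.
  by move=> z's; apply: s_mu; rewrite inE z's orbT.
have [K K0 HK] := IH _ s_mu' annW i j.
have := geometric_recurrence_bound (a := fun t => `|(A ^+ t * W) i j|)
  (normr_ge0 _) (normr_ge0 z) z_mu K0 => bound.
exists (`|(A ^+ 0 * W) i j| + K / (mu - `|z|)).
  by rewrite addr_ge0// divr_ge0// subr_ge0 ltW.
apply: bound => t.
have -> : A ^+ t.+1 * W = z *: (A ^+ t * W)
    + A ^+ t * (horner_mx A ('X - z%:P) * W).
  rewrite rmorphB /= horner_mx_X horner_mx_C mulrBl mulrBr exprSr mulrA.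
  rewrite -[in LHS]mulrA -[z%:M * W]/(z%:M *m W) mul_scalar_mx -scalerAr.
  by rewrite addrC subrK mulrA.
rewrite mxE; apply: le_trans (ler_normD _ _) _.
by rewrite mxE normrM lerD.
Qed.

Section PowerBound.
Variables (R : realType).

(** Cayley-Hamilton makes the product over all eigenvalues annihilate the identity, which bounds
    each entry of the powers; the Frobenius norm assembles the entries. *)
Lemma spectral_norm_exp_bound n (A : 'M[R]_n) (mu : R) :
  spectral_radius A < mu ->
  exists2 K : R, 0 <= K & forall t, spectral_norm (A ^+ t) <= K * mu ^+ t.
Proof.
case: n A => [|n] A rho_mu.
  exists 0 => // t; rewrite mul0r; apply: spectral_norm_le => x _.
  by rewrite /l2norm big_ord0 sqrtr0.
have rho_ge0 : 0 <= spectral_radius A by exact: bigmax_ge_id.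
have mu_ge0 : 0 <= mu by apply: le_trans (ltW rho_mu).
set AC := map_mx (real_complex R) A.
have annA : horner_mx AC (\prod_(z <- eigenvalues A) ('X - z%:P)) * 1 = 0.
  by rewrite mulr1 -char_poly_eigenvalues Cayley_Hamilton.
have eig_mu z : z \in eigenvalues A -> `|z| < mu%:C%C.
  by move=> /norm_eigenvalue_le /le_lt_trans; apply; rewrite ltcR.
have entry i j : exists2 K : R, 0 <= K & forall t, `|(A ^+ t) i j| <= K * mu ^+ t.
  have [K K0 HK] := annihilated_powers_bound eig_mu annA i j.
  (* Being nonnegative in the order of [R[i]] forces [K] to be real. *)
  have KE : K = (complex.Re K)%:C%C by apply/esym/RRe_real/ger0_real.
  exists (complex.Re K); first by rewrite -lecR -KE.
  move=> t; have := HK t; rewrite mulr1 -rmorphXn /= mxE.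
  rewrite normc_def /= expr0n addr0 sqrtr_sqr.
  by rewrite KE -rmorphXn -rmorphM lecR.
(* The constants depend on the entry but not on [t]; choice collects them into one family. *)
have [K HK] : exists K : 'I_n.+1 -> 'I_n.+1 -> R, forall i j,
    0 <= K i j /\ forall t, `|(A ^+ t) i j| <= K i j * mu ^+ t.
  have /choice[f Hf] : forall ij : 'I_n.+1 * 'I_n.+1, exists K : R,
      0 <= K /\ forall t, `|(A ^+ t) ij.1 ij.2| <= K * mu ^+ t.
    by move=> [i j]; have [K] := entry i j; exists K.
  by exists (fun i j => f (i, j)) => i j; exact: (Hf (i, j)).
exists (Num.sqrt (\sum_i \sum_j K i j ^+ 2)); first exact: sqrtr_ge0.
move=> t; apply: le_trans (spectral_norm_le_frobenius _) _.
rewrite -[X in _ * X](ger0_norm (exprn_ge0 t mu_ge0)) -sqrtr_sqr -sqrtrM; last first.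
  by apply: sumr_ge0 => i _; apply: sumr_ge0 => j _; exact: sqr_ge0.
rewrite ler_wsqrtr// mulr_suml; apply: ler_sum => i _; rewrite mulr_suml.
apply: ler_sum => j _; have [K0 Ht] := HK i j.
rewrite -exprMn -[leLHS]real_normK ?num_real// ler_pXn2r ?nnegrE//.
by rewrite mulr_ge0// exprn_ge0.
Qed.

Lemma powR_half_natr (r : R) (t : nat) : 0 <= r ->
  r `^ (t%:R / 2) = Num.sqrt r ^+ t.
Proof.
by move=> r0; rewrite mulrC powRrM powR12_sqrt// powR_mulrn// sqrtr_ge0.
Qed.

Lemma Phi_fin_num n (A : 'M[R]_n) :
  0 < spectral_radius A -> spectral_radius A < 1 -> Phi A \is a fin_num.
Proof.
move=> rho_gt0 rho_lt1.
have sqrt_gt0 : 0 < Num.sqrt (spectral_radius A) by rewrite sqrtr_gt0.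
have rho_sqrt : spectral_radius A < Num.sqrt (spectral_radius A).
  rewrite -[ltLHS]sqr_sqrtr ?ltW// expr2 gtr_pMr//.
  by rewrite -[ltRHS]sqrtr1 ltr_sqrt.
have [K K0 HK] := spectral_norm_exp_bound rho_sqrt.
rewrite fin_numElt; apply/andP; split.
  (* The term at [tau = 0] is real and below the supremum, which excludes minus infinity. *)
  apply: lt_le_trans (ltNyr _) _; last first.
    by apply: ereal_sup_ubound; exists 0%N.
apply: (@le_lt_trans _ _ K%:E); last exact: ltry.
apply: ge_ereal_sup => _ [t _ <-]; rewrite lee_fin (powR_half_natr _ (ltW rho_gt0)).
by rewrite ler_pdivrMr// exprn_gt0.
Qed.

Lemma spectral_norm_exp_le_Phi n (A : 'M[R]_n) t :
  0 < spectral_radius A -> spectral_radius A < 1 ->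
  spectral_norm (A ^+ t) <= fine (Phi A) * Num.sqrt (spectral_radius A) ^+ t.
Proof.
move=> rho_gt0 rho_lt1.
rewrite -ler_pdivrMr ?exprn_gt0 ?sqrtr_gt0//.
rewrite -(powR_half_natr _ (ltW rho_gt0)).
rewrite -lee_fin fineK ?Phi_fin_num//.
by apply: ereal_sup_ubound; exists t.
Qed.

End PowerBound.

(** * Norm of the true Hankel matrix *)

(** Cauchy-Schwarz between [C] and [A^i A^j B]. Splitting the power separates the row index from the
    column index and is the origin of the square of [Phi]. *)
Lemma markov_le (R : realType) n (A : 'M[R]_n) (B : 'cV[R]_n) (C : 'rV[R]_n) i j :
  `|markov A B C (i + j)| <=
  l2norm C^T * l2norm B * (spectral_norm (A ^+ i) * spectral_norm (A ^+ j)).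
Proof.
have -> : markov A B C (i + j) = (C *m (A ^+ i *m (A ^+ j *m B))) 0 0.
  by rewrite /markov exprD !mulmxA.
apply: le_trans (dot_le_l2norm _ _) _.
rewrite -[leRHS]mulrA ler_wpM2l ?l2norm_ge0//.
apply: le_trans (l2norm_mulmx_le _ _) _.
rewrite [leRHS]mulrC -mulrA ler_wpM2l ?spectral_norm_ge0//.
exact: l2norm_mulmx_le.
Qed.

(** The squared Frobenius norm is at most [c^2] times a geometric sum over rows times one over
    columns. Enlarging the row sum to the column sum [G] leaves the perfect square [(c * G)^2] under
    the root. *)
Lemma spectral_norm_hankel_plus_markov (R : realType) n p (A : 'M[R]_n)
    (B : 'cV[R]_n) (C : 'rV[R]_n) :
  0 < spectral_radius A -> spectral_radius A < 1 -> (n <= p)%N ->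
  spectral_norm (hankel_plus n p (markov A B C)) <=
  fine (Phi A) ^+ 2 * l2norm C^T * l2norm B
  * ((1 - spectral_radius A ^+ p.+1) / (1 - spectral_radius A)).
Proof.
move=> rho_gt0 rho_lt1 n_le_p; set rho := spectral_radius A.
have rho_ge0 := ltW rho_gt0.
set G := (1 - _) / _.
have geomE m : \sum_(i < m) rho ^+ i = (1 - rho ^+ m) / (1 - rho).
  have h : 1 - rho != 0 by rewrite subr_eq0 gt_eqF.
  by apply: (mulIf h); rewrite divfK// mulrC -[RHS]opprB subrX1 -mulNr opprB.
have G_ge0 : 0 <= G.
  by rewrite /G -geomE sumr_ge0// => i _; rewrite exprn_ge0.
set c := fine (Phi A) ^+ 2 * l2norm C^T * l2norm B.
have c_ge0 : 0 <= c.
  by rewrite /c -mulrA mulr_ge0 ?sqr_ge0 ?mulr_ge0 ?l2norm_ge0.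
have entry i j : markov A B C (i + j) ^+ 2 <= c ^+ 2 * (rho ^+ i * rho ^+ j).
  have -> : c ^+ 2 * (rho ^+ i * rho ^+ j) =
      (c * (Num.sqrt rho ^+ i * Num.sqrt rho ^+ j)) ^+ 2.
    by rewrite !exprMn ![(Num.sqrt rho ^+ _) ^+ 2]exprAC (sqr_sqrtr rho_ge0).
  rewrite -[leLHS]real_normK ?num_real// ler_pXn2r ?nnegrE//; last first.
    by apply: mulr_ge0 => //; apply: mulr_ge0; rewrite exprn_ge0 ?sqrtr_ge0.
  apply: le_trans (markov_le _ _ _ _ _) _.
  have -> : c * (Num.sqrt rho ^+ i * Num.sqrt rho ^+ j) =
      l2norm C^T * l2norm B * ((fine (Phi A) * Num.sqrt rho ^+ i)
                               * (fine (Phi A) * Num.sqrt rho ^+ j)).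
    by rewrite /c; ring.
  apply: ler_wpM2l; first by rewrite mulr_ge0 ?l2norm_ge0.
  by apply: ler_pM; rewrite ?spectral_norm_ge0 ?spectral_norm_exp_le_Phi.
apply: le_trans (spectral_norm_le_frobenius _) _.
rewrite -(ger0_norm (mulr_ge0 c_ge0 G_ge0)) -sqrtr_sqr ler_wsqrtr//.
apply: (@le_trans _ _ (\sum_(i < n) \sum_(j < p + 1) c ^+ 2 * (rho ^+ i * rho ^+ j))).
  by apply: ler_sum => i _; apply: ler_sum => j _; rewrite !mxE entry.
under eq_bigr do rewrite -2!mulr_sumr.
rewrite -mulr_sumr -mulr_suml [leRHS]exprMn ler_wpM2l ?sqr_ge0// !geomE expr2.
(* The column sum is already [G]; the row sum has [n <= p + 1] terms and is therefore at most
   [G]. *)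
rewrite addn1 -/G; apply: ler_wpM2r => //.
apply: ler_wpM2r; first by rewrite invr_ge0 subr_ge0 ltW.
by rewrite lerD2l lerN2 ler_wiXn2l ?(ltW rho_lt1)// leqW.
Qed.

Theorem lemma4 (R : realType) (nx p n : nat)
    (A : 'M[R]_nx) (B : 'cV[R]_nx) (C : 'rV[R]_nx) (ghat : nat -> R)
    (hrho_gt0 : 0 < spectral_radius A) (hrho_lt1 : spectral_radius A < 1)
    (hctrb : controllable A B) (hobsv : observable A C)
    (hp : (nx <= p)%N) (hn : n = (nx + p + 1)%N) :
  let g := markov A B C in
  let sigma_hat := singular_value (nx + 1) (hankel nx p ghat) in
  let sigma_hat_plus := singular_value nx (hankel_plus nx p ghat) in
  let delta_hat := sigma_hat_plus - sigma_hat in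
  let H_err := hankel_plus nx p ghat - hankel_plus nx p g in
  Phi A \is a fin_num /\
  delta_hat <= sigma_hat_plus /\
  sigma_hat_plus <=
    fine (Phi A) ^+ 2 * l2norm C^T * l2norm B
      * ((1 - spectral_radius A ^+ (n - nx)) / (1 - spectral_radius A))
    + spectral_norm H_err.
Proof.
move=> g sigma_hat sigma_hat_plus delta_hat H_err.
split; first exact: Phi_fin_num.
split.
  rewrite gerBl.
  by have /andP[] := singular_value_bounds (nx + 1) (hankel nx p ghat).
have /andP[_ /le_trans] := singular_value_bounds nx (hankel_plus nx p ghat); apply.
have -> : hankel_plus nx p ghat = hankel_plus nx p g + H_err.
  by rewrite /H_err addrC subrK.
apply: le_trans (spectral_normD _ _) _; rewrite lerD2r.
(* The exponent is the number of columns, hence the number of terms of the geometric sum. *)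
have -> : (n - nx)%N = p.+1 by rewrite hn -addnA addKn addn1.
exact: spectral_norm_hankel_plus_markov.
Qed.
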